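(* Let $n$ be a positive integer. Then $\omega_n$ is the least ordinal $\gamma$ such that there is no $n$-dimensional tail-acyclic simplicial complex on $\gamma$.
   Context: An (abstract) simplicial complex $B$ on an ordinal $\gamma$ is a family of nonempty finite subsets of $\gamma$ closed under taking nonempty subsets; its $k$-faces are its members of size $k+1$, and $B^k\subseteq[\gamma]^{k+1}$ denotes the set of $k$-faces. The dimension of $B$ is $\sup\{k : B^k\neq\varnothing\}$. Faces are identified with strictly increasing tuples. Let $C_k(B)$ be the free abelian group on generators $\langle\vec\alpha\rangle$, $\vec\alpha\in B^k$, with boundary maps $\partial_k\langle\vec\alpha\rangle=\sum_{i\le k}(-1)^i\langle\vec\alpha^i\rangle$, where $\vec\alpha^i$ is $\vec\alpha$ with its $i$-th coordinate (counting from $0$) removed. The reduced simplicial homology groups $\tilde{\mathrm H}^\Delta_k(B)=\ker\partial_k/\mathrm{im}\,\partial_{k+1}$ ($k\ge 0$) are computed with $C_{-1}(B)=\mathbb Z$ and $\partial_0\langle\alpha\rangle=1$. For $X\subseteq\gamma$, $B|_X$ is the subcomplex of faces contained in $X$. An $n$-dimensional simplicial complex $G$ on $\gamma$ is tail-acyclic if $G^{n-1}=[\gamma]^n$ (all $n$-element subsets of $\gamma$ are faces) and $\tilde{\mathrm H}^\Delta_k(G|_{[\alpha,\gamma)})=0$ for all $\alpha<\gamma$ and all $k\ge 0$.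
   Formalization: The formal statement says that ω_n is the least ordinal γ > n with no n-dimensional tail-acyclic complex; the restriction γ > n is added because an ordinal γ ≤ n (e.g. γ = 0) has no n-faces and so trivially carries no n-dimensional complex. *)

(* Defs.v *)
From HB Require Import structures.
From mathcomp Require Import all_boot all_order all_algebra.
From mathcomp Require Import finmap.
From mathcomp Require Import boolp classical_sets cardinality wochoice.
From mathcomp Require Import freeg.

Set Implicit Arguments.
Unset Strict Implicit.
Unset Printing Implicit Defensive.

Import Order.TTheory GRing.Theory.

Local Open Scope classical_set_scope.

(** * Ordinals, represented by well-ordered types *)

Record wotype := WOType {
  wo_disp : Order.disp_t;
  wo_sort :> orderType wo_disp;
  wo_wf : well_founded (fun x y : wo_sort => (x < y)%O) }.

(* [b] is order-isomorphic to the proper initial segment of [g] below [x];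
   this is the order of ordinals, transported to order types. *)
Definition ord_lt (b g : wotype) : Prop :=
  exists (x : g) (f : b -> g),
    {mono f : y z / (y < z)%O} /\ range f = [set y | (y < x)%O].

Definition is_least (P : wotype -> Prop) (g : wotype) : Prop :=
  P g /\ forall b, ord_lt b g -> ~ P b.

Fixpoint is_omega (n : nat) (g : wotype) : Prop :=
  if n is m.+1 then
    exists2 k : wotype, is_omega m k &
      is_least (fun b : wotype => ~ exists f : b -> k, injective f) g
  else is_least (fun b : wotype => infinite_set [set: b]) g.

Lemma fin_ord_wf n : well_founded (fun x y : 'I_n => (x < y)%O).
Proof.
suff H m (x : 'I_n) : (x < m)%N -> Acc (fun x y : 'I_n => (x < y)%O) x.
  by move=> x; exact: (H n x (ltn_ord x)).
elim: m x => [x|m IH x xm]; first by rewrite ltn0.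
constructor=> y yx; apply: IH.
by rewrite -ltnS; apply: leq_trans xm; rewrite ltnS.
Qed.

(* An ordinal [g <= n] has no subset of size [n.+1], hence carries no
   [n]-dimensional complex at all; [ord_lt (fin_ord n) g] excludes this
   degenerate case. *)
Definition fin_ord (n : nat) : wotype := WOType (@fin_ord_wf n).

(** * Existence of the ordinals [omega_n] *)

Lemma ord_lt_wf : well_founded ord_lt.
Proof.
suff Hx (g : wotype) (x : g) (b : wotype) (f : b -> g) :
    {mono f : y z / (y < z)%O} -> range f = [set y | (y < x)%O] -> Acc ord_lt b.
  by move=> g; constructor=> b [x [f [fm fr]]]; apply: Hx fm fr.
elim/(well_founded_ind (@wo_wf g)): x b f => x IH b f fm fr.
have segP (u v : wotype) (w : v) (h : u -> v) (z : u) :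
    range h = [set y | (y < w)%O] -> (h z < w)%O.
  by move=> /seteqP[/(_ (h z)) + _]; apply; exists z.
constructor=> c [y [h [hm hr]]].
apply: (IH (f y) _ c (f \o h)); first exact: segP fr.
  by move=> u v /=; rewrite fm hm.
apply/seteqP; split=> z /=.
  by move=> [u _ <-]; rewrite /= fm; apply: segP hr.
move=> zy; have [t _ tz] : range f z.
  by rewrite fr /=; apply: (lt_trans zy); apply: segP fr.
move: zy; rewrite -tz fm => ty.
have [u _ ut] : range h t by rewrite hr.
by exists u => //=; rewrite ut.
Qed.

Lemma is_least_exists (P : wotype -> Prop) g : P g -> exists b, is_least P b.
Proof.
elim/(well_founded_ind ord_lt_wf): g => g IH Pg.
have [[b bg Pb]|H] := pselect (exists2 b, ord_lt b g & P b); first exact: IH Pb.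
by exists g; split=> // b bg Pb; apply: H; exists b.
Qed.

Definition order_of (T : choiceType) (R : rel T) (rR : reflexive R)
  (aR : antisymmetric R) (trR : transitive R) (tR : total R) : Type := T.

Section OrderOf.
Variables (T : choiceType) (R : rel T) (rR : reflexive R).
Variables (aR : antisymmetric R) (trR : transitive R) (tR : total R).
Local Notation A := (order_of rR aR trR tR).
HB.instance Definition _ := Choice.on A.
HB.instance Definition _ :=
  Order.Le_isPOrder.Build (Order.Disp tt tt) A rR aR trR.
HB.instance Definition _ :=
  Order.POrder_isTotal.Build (Order.Disp tt tt) A tR.
End OrderOf.

Lemma wotype_on (T : choiceType) :
  exists (g : wotype) (f : T -> g), injective f.
Proof.
have [R wR] := well_ordering_principle T.
have tR : total R.
  move=> x y; have [|z [[]]] := wR (pred2 x y); first by exists x; rewrite inE eqxx.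
  rewrite !inE => /orP[]/eqP-> lb _; first by rewrite (lb y) // !inE eqxx orbT.
  by rewrite (lb x) ?orbT // !inE eqxx.
have rR : reflexive R by move=> x; have := tR x x; rewrite orbb.
have aR : antisymmetric R.
  move=> x y /andP[xy yx]; have [|z [_ uz]] := wR (pred2 x y).
    by exists x; rewrite inE eqxx.
  rewrite -(uz x) ?(uz y) //; split; rewrite ?inE ?eqxx ?orbT // => t;
    by rewrite !inE => /orP[]/eqP->.
have trR : transitive R.
  move=> y x z xy yz; have [|m [[]]] := wR (pred3 x y z).
    by exists x; rewrite inE eqxx.
  rewrite !inE => /or3P[]/eqP-> lb _.
  - by apply: lb; rewrite !inE eqxx !orbT.
  - suff -> : x = y by [].
    by apply: aR; rewrite xy lb // !inE eqxx.
  - suff -> : z = y by [].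
    by apply: aR; rewrite yz lb // !inE eqxx orbT.
pose T2 : orderType (Order.Disp tt tt) := order_of rR aR trR tR.
have wf2 : well_founded (fun x y : T2 => (x < y)%O).
  move=> x; apply: contrapT => nx.
  have [|m [[]]] := wR [pred y | `[< ~ Acc (fun x y : T2 => (x < y)%O) y >]].
    by exists x; apply/asboolP.
  move=> /asboolP nm lb _; apply: nm; constructor=> y ym.
  apply: contrapT => ny; have : R m y by apply: lb; apply/asboolP.
  by move=> my; have := lt_le_trans ym (my : ((m : T2) <= y)%O); rewrite ltxx.
by exists (WOType wf2), id.
Qed.

Lemma omega_exists n : exists g, is_omega n g.
Proof.
elim: n => [|n [k omk]] /=.
  have [g [h hI]] := wotype_on nat.
  apply: (@is_least_exists _ g) => gfin; apply: infinite_nat.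
  by apply: (@finite_preimage _ _ [set: g] h) => // x y _ _; exact: hI.
have [g [h hI]] := wotype_on (set k).
have [b bl] : exists b, is_least (fun b : wotype => ~ exists f : b -> k, injective f) b.
  apply: (@is_least_exists _ g) => -[e eI].
  pose f := e \o h; have fI : injective f by exact: inj_comp.
  pose D := [set x | exists2 A : set k, f A = x & ~ A x].
  have nD : ~ D (f D) by move=> DD; have [A /fI ->] := DD.
  by apply: (nD); exists D.
by exists b, k.
Qed.

(** * Simplicial complexes *)

Section Complexes.
Variables (d : Order.disp_t) (T : orderType d).
Implicit Types (s t : {fset T}) (k : nat).

Record complex := Complex {
  is_face : set {fset T};
  face_neq0 : forall s, is_face s -> s != fset0;
  face_sub : forall s t,
    is_face s -> (t `<=` s)%fset -> t != fset0 -> is_face t }.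

Implicit Types B : complex.

Definition faces B k : set {fset T} := [set s | is_face B s /\ #|` s| = k.+1].

(* The dimension of [B], as the supremum (here a maximum) of the [k] such that
   [B] has a [k]-face, is equal to [n]. *)
Definition has_dim B n : Prop :=
  faces B n !=set0 /\ forall k, faces B k !=set0 -> (k <= n)%N.

Definition res_face B (X : set T) : set {fset T} :=
  [set s | is_face B s /\ [set` s] `<=` X].

Lemma res_neq0 B X s : res_face B X s -> s != fset0.
Proof. by move=> [/face_neq0]. Qed.

Lemma res_sub B X s t :
  res_face B X s -> (t `<=` s)%fset -> t != fset0 -> res_face B X t.
Proof.
move=> [Bs sX] ts t0; split; first exact: face_sub Bs ts t0.
by move=> x /= xt; apply: sX => /=; apply: (fsubsetP ts).
Qed.

Definition restrict B X : complex :=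
  Complex (@res_neq0 B X) (@res_sub B X).

(* A chain is an element of the free abelian group on all finite subsets of
   [T]; C_k(B) is the subgroup of those supported on the [k]-faces of [B]. *)
Definition chains B k : set {freeg {fset T} / int} :=
  [set c | forall s, s \in dom c -> faces B k s].

Definition del_nth (i : nat) (a : seq T) : seq T := take i a ++ drop i.+1 a.

Definition bd_simplex s : {freeg {fset T} / int} :=
  let a := sort <=%O (enum_fset s) in
  (\sum_(i < size a) (-1) ^+ i *: << [fset x in del_nth i a]%fset >>)%R.

Definition bd : {freeg {fset T} / int} -> {freeg {fset T} / int} :=
  fglift bd_simplex.

(* For [k = 0] the target of the boundary map is C_{-1}(B) = Z, and every
   generator is sent to 1, so that the map is the sum of the coefficients. *)
Definition cycles B k : set {freeg {fset T} / int} :=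
  [set c | chains B k c /\ (if k is 0 then deg c = 0 else bd c = 0)%R].

Definition boundaries B k : set {freeg {fset T} / int} :=
  bd @` chains B k.+1.

(* Vanishing of the quotient ker / im. *)
Definition reduced_homology_trivial B k : Prop :=
  cycles B k `<=` boundaries B k.

Definition tail_acyclic n B : Prop :=
  [/\ has_dim B n,
      faces B n.-1 = [set s | #|` s| = n] &
      forall (x : T) k,
        reduced_homology_trivial (restrict B [set y | (x <= y)%O]) k].

End Complexes.

(* Main.v *)
Require Import Defs.
From HB Require Import structures.
From mathcomp Require Import all_boot all_order all_algebra.
From mathcomp Require Import finmap.
From mathcomp Require Import boolp classical_sets cardinality.
From mathcomp Require Import freeg.

Set Implicit Arguments.
Unset Strict Implicit.
Unset Printing Implicit Defensive.

Import Order.TTheory GRing.Theory.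

(** The n-simplices of a tail-acyclic complex G are such that, for every a, the
    boundaries of those above a form a basis of the (n-1)-cycles of the full
    simplex on the vertices above a ("tail basis").

    Existence.  If X has cardinal at most aleph_(n-1), enumerate it so that
    every proper initial segment has smaller cardinal (is finite when n = 1).
    Taking links at the last vertex y of a cycle reduces the search for a tail
    basis in dimension n to tail bases in dimension n-1 of the segments below y;
    in dimension 0 the maximum of a finite set does it.

    Non-existence.  A tail-acyclic complex on omega_n yields a linear retraction
    q of the n-chains onto the n-cycles that respects all tails.  For N closed
    under q and strictly bounded by a vertex b, coning with b turns q into such
    a retraction in dimension n-1 on N (Osofsky's argument).  Choosing N of
    cardinal aleph_(n-1) so that its subsets of smaller cardinal are bounded in
    N, one descends to a retraction of 0-chains on a set without maximum, which
    is absurd: 1 - q would send all vertices to a single chain of augmentation 1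
    lying in every tail. *)

(** * Chains and their supports *)

Section Supported.
Variable K : choiceType.
Implicit Types (P Q : set K) (c : {freeg K / int}).
Local Open Scope ring_scope.

Definition supported P c := forall s, s \in dom c -> P s.

Lemma supported0 P : supported P 0.
Proof. by move=> s; rewrite dom0. Qed.

Lemma supportedD P c1 c2 : supported P c1 -> supported P c2 -> supported P (c1 + c2).
Proof.
by move=> h1 h2 s /domD_subset; rewrite mem_cat => /orP[/h1|/h2].
Qed.

Lemma supportedN P c : supported P c -> supported P (- c).
Proof. by move=> h s; rewrite domN; apply: h. Qed.

Lemma supportedB P c1 c2 : supported P c1 -> supported P c2 -> supported P (c1 - c2).
Proof. by move=> h1 h2; apply: supportedD => //; apply: supportedN. Qed.

Lemma supportedZ P (k : int) c : supported P c -> supported P (k *: c).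
Proof. by move=> h s /domZ_subset; apply: h. Qed.

Lemma supportedU P s : P s -> supported P << s >>.
Proof. by move=> Ps t; rewrite domU1 inE => /eqP->. Qed.

Lemma supported_sum P (I : eqType) (r : seq I) (F : I -> {freeg K / int}) :
  (forall i, i \in r -> supported P (F i)) -> supported P (\sum_(i <- r) F i).
Proof.
move=> h; rewrite big_seq; elim/big_ind: _ => //; [exact: supported0|exact: supportedD].
Qed.

Lemma supported_subset P Q c :
  supported P c -> (forall s, P s -> Q s) -> supported Q c.
Proof. by move=> h PQ s /h/PQ. Qed.

Lemma supported_eq0 c : supported (fun=> False) c -> c = 0.
Proof.
move=> h; apply/eqP; rewrite -dom_eq0; apply/eqP; case E: (dom c) => [//|a s].
by case: (h a); rewrite E mem_head.
Qed.

Lemma supported_self c : supported (fun s => s \in dom c) c.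
Proof. by []. Qed.

Lemma supported_ind P (Q : {freeg K / int} -> Prop) :
  Q 0 -> (forall c1 c2, Q c1 -> Q c2 -> Q (c1 + c2)) ->
  (forall (k : int) s, P s -> Q (k *: << s >>)) ->
  forall c, supported P c -> Q c.
Proof.
move=> Q0 QD QU c h; rewrite -(freeg_sumE c) big_seq.
elim/big_ind: _ => // s /h Ps.
suff -> : << coeff s c *g s >> = coeff s c *: << s >> by exact: QU.
by apply/eqP/freeg_eqP => t; rewrite coeffZ !coeffU mul1r.
Qed.

(** The scalars are integers, so additivity alone forces linearity. Composites can thus be compared
    on generators without being presented as a single [fglift]. *)
Lemma eq_supported (M : zmodType) (F G : {freeg K / int} -> M) P c :
  {morph F : x y / x + y} -> {morph G : x y / x + y} ->
  (forall s, P s -> F << s >> = G << s >>) -> supported P c -> F c = G c.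
Proof.
move=> Fa Ga FG.
have F0 (H : {freeg K / int} -> M) : {morph H : x y / x + y} -> H 0 = 0.
  by move=> Ha; apply: (addrI (H 0)); rewrite -Ha !addr0.
have FN (H : {freeg K / int} -> M) x : {morph H : x y / x + y} -> H (- x) = - H x.
  by move=> Ha; apply/eqP; rewrite -addr_eq0 -Ha addNr F0.
have Fn (H : {freeg K / int} -> M) x n :
    {morph H : x y / x + y} -> H (x *+ n) = H x *+ n.
  by move=> Ha; elim: n => [|n IH]; rewrite ?mulr0n ?F0 // !mulrS Ha IH.
move: c; apply: supported_ind => [|c1 c2 e1 e2|k s Ps].
- by rewrite !F0.
- by rewrite Fa Ga e1 e2.
- have -> : k *: << s >> = << s >> *~ k :> {freeg K / int} by rewrite -scaler_int intz.
  by case: k => n; rewrite ?NegzE ?mulrNz -?pmulrn ?(FN F) ?(FN G) ?(Fn F) ?(Fn G) // FG.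
Qed.

Lemma eq_freeg (M : zmodType) (F G : {freeg K / int} -> M) :
  {morph F : x y / x + y} -> {morph G : x y / x + y} ->
  (forall s, F << s >> = G << s >>) -> F =1 G.
Proof. by move=> Fa Ga FG c; apply: (@eq_supported _ F G setT). Qed.

Section Lift.
Variables (M : lmodType int) (f : K -> M).

Lemma fgliftB : {morph fglift f : x y / x - y}.
Proof. exact: lift_is_additive. Qed.

Lemma fglift0 : fglift f 0 = 0.
Proof. by rewrite -[X in fglift f X](subrr 0) fgliftB subrr. Qed.

Lemma fgliftN : {morph fglift f : x / - x}.
Proof. by move=> x; rewrite -sub0r fgliftB fglift0 sub0r. Qed.

Lemma fgliftD : {morph fglift f : x y / x + y}.
Proof. by move=> x y; rewrite -{1}(opprK y) fgliftB fgliftN opprK. Qed.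

Lemma fgliftU s : fglift f << s >> = f s.
Proof. by rewrite liftU scale1r. Qed.

Lemma fgliftZ (k : int) c : fglift f (k *: c) = k *: fglift f c.
Proof.
move: c; apply: (eq_freeg (F := fun c => fglift f (k *: c))
  (G := fun c => k *: fglift f c)) => [x y|x y|s].
- by rewrite scalerDr fgliftD.
- by rewrite fgliftD scalerDr.
rewrite fgliftU -[RHS](liftU f); congr fglift.
by apply/eqP/freeg_eqP => t; rewrite coeffZ !coeffU mul1r.
Qed.

Lemma fglift_sum (I : Type) (r : seq I) (F : I -> {freeg K / int}) :
  fglift f (\sum_(i <- r) F i) = \sum_(i <- r) fglift f (F i).
Proof. exact: (big_morph _ fgliftD fglift0). Qed.

End Lift.

End Supported.
Arguments supported_self {K} c.

Lemma supported_lift (K L : choiceType) (f : K -> {freeg L / int})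
    (P : set K) (Q : set L) c :
  supported P c -> (forall s, P s -> supported Q (f s)) ->
  supported Q (fglift f c).
Proof.
move=> + h; move: c; apply: supported_ind => [|c1 c2 h1 h2|k s Ps].
- by rewrite fglift0; apply: supported0.
- by rewrite fgliftD; apply: supportedD.
- by rewrite fgliftZ fgliftU; apply: supportedZ; apply: h.
Qed.

(** * The boundary, cones and links *)

Section Exterior.
Variables (d : Order.disp_t) (T : orderType d).
Implicit Types (s t : {fset T}) (x y : T) (c : {freeg {fset T} / int}).
Local Open Scope fset_scope.
Local Open Scope ring_scope.

(** [x] need not belong to [s], so that the same sign serves for inserting a vertex and for deleting
    it. *)
Definition pos x s : nat := #|` [fset t in s | (t < x)%O]|.
Definition sgn x s : int := (-1) ^+ pos x s.

Lemma sgn_sq x s : sgn x s * sgn x s = 1.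
Proof. by rewrite /sgn -expr2 sqrr_sign. Qed.

Lemma posU1 x y s : y \notin s -> pos x (y |` s) = ((y < x)%O + pos x s)%N.
Proof.
move=> ys; rewrite /pos; case: (boolP (y < x)%O) => yx /=.
  have -> : [fset t in y |` s | (t < x)%O] = y |` [fset t in s | (t < x)%O].
    by apply/fsetP => t; rewrite !inE; case: eqP => [->|_]; rewrite ?yx.
  by rewrite cardfsU1 !inE (negPf ys).
have -> // : [fset t in y |` s | (t < x)%O] = [fset t in s | (t < x)%O].
by apply/fsetP => t; rewrite !inE; case: eqP => [->|_]; rewrite //= (negPf ys) (negPf yx).
Qed.

(** The index of a vertex in the sorted list is the number of smaller vertices, so sorted lists can
    be forgotten from here on. *)
Lemma bd_simplexE s : bd_simplex s = \sum_(x <- s) sgn x s *: << s `\ x >>.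
Proof.
rewrite /bd_simplex; set a := sort _ _.
have pa : perm_eq a s by rewrite perm_sort.
rewrite -(perm_big _ pa) /=.
have ua : uniq a by rewrite (perm_uniq pa) fset_uniq.
have sa : sorted <%O a by rewrite lt_sorted_uniq_le ua sort_le_sorted.
have ma := perm_mem pa.
case: (posnP (size a)) => [/size0nil ->|a0]; first by rewrite big_ord0 big_nil.
have x0 : T by case: (a) a0.
rewrite (big_nth x0) big_mkord; apply: eq_bigr => i _.
have ia := ltn_ord i.
have -> : sgn (nth x0 a i) s = (-1) ^+ i.
  rewrite /sgn /pos; congr (_ ^+ _).
  have -> : [fset t in s | (t < nth x0 a i)%O] = [fset t in take i a].
    apply/fsetP => t; rewrite !inE -ma; apply/idP/idP.
      move=> /andP[ta]; rewrite -(nth_index x0 ta) => lt.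
      rewrite in_take_leq ?(ltnW ia) //; first by rewrite nth_index // in lt *;
        rewrite -(lt_sorted_ltn_nth x0 sa) ?inE ?index_mem ?nth_index.
    move=> ti; have ta := mem_take ti; rewrite ta -{1}(nth_index x0 ta).
    by rewrite (lt_sorted_ltn_nth x0 sa) ?inE ?index_mem // -in_take_leq // ltnW.
  by rewrite card_fseq undup_id ?take_uniq // size_takel // ltnW.
congr (_ *: << _ >>); apply/fsetP => t; rewrite !inE /del_nth -ma.
have Ea : a = take i a ++ nth x0 a i :: drop i.+1 a.
  by rewrite -drop_nth // cat_take_drop.
have := ua; rewrite {1}Ea cat_uniq /= negb_or => /and4P[_ /andP[nt _] nd _].
have -> : (t \in a) = [|| t \in take i a, t == nth x0 a i | t \in drop i.+1 a].
  by rewrite {1}Ea mem_cat inE.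
by case: eqP => [->|_] /=; rewrite ?(negPf nt) ?(negPf nd).
Qed.

Lemma bdE s : bd << s >> = \sum_(x <- s) sgn x s *: << s `\ x >>.
Proof. by rewrite /bd fgliftU bd_simplexE. Qed.

Lemma bdD : {morph @bd _ T : x y / x + y}. Proof. exact: fgliftD. Qed.
Lemma bdB : {morph @bd _ T : x y / x - y}. Proof. exact: fgliftB. Qed.
Lemma bd0 : @bd _ T 0 = 0. Proof. exact: fglift0. Qed.

(** Exterior multiplication by [y]; [link_simplex] is the corresponding contraction. *)
Definition cone_simplex y s : {freeg {fset T} / int} :=
  if y \in s then 0 else sgn y s *: << y |` s >>.
Definition cone y := fglift (cone_simplex y).

Definition link_simplex y s : {freeg {fset T} / int} :=
  if y \in s then sgn y s *: << s `\ y >> else 0.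
Definition link y := fglift (link_simplex y).

Lemma sgnU1 x s : x \notin s -> sgn x (x |` s) = sgn x s.
Proof. by move=> xs; rewrite /sgn posU1 // ltxx. Qed.

Lemma sgnD1 x s : x \in s -> sgn x (s `\ x) = sgn x s.
Proof. by move=> xs; rewrite -[in RHS](fsetD1K xs) sgnU1 // !inE eqxx. Qed.

(** Exactly one of [x < y] and [y < x] holds, so the exponents of the two products differ by one. *)
Lemma sgn_anticomm x y s : x \in s -> y \notin s ->
  sgn y s * sgn x (y |` s) + sgn x s * sgn y (s `\ x) = 0.
Proof.
move=> xs ys; rewrite /sgn posU1 // -{1}(fsetD1K xs) posU1 ?inE ?eqxx // -!exprD.
have : x != y by apply: contraNneq ys => <-.
case: ltgtP => //= _ _;
  rewrite ?add0n ?add1n ?addnS ?addSn addnC exprS mulN1r addrC ?addNr ?addrN //.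
all: by rewrite addnC subrr.
Qed.

(** Coning is a contracting homotopy. The empty simplex is a generator here, so the complex of all
    finite subsets is the augmented one. *)
Lemma bd_cone y c : bd (cone y c) + cone y (bd c) = c.
Proof.
move: c; apply: (eq_freeg (F := fun c => bd (cone y c) + cone y (bd c)) (G := id)).
- by move=> c1 c2; rewrite /cone bdD !fgliftD bdD addrACA.
- by [].
move=> s; rewrite bdE /cone fglift_sum fgliftU.
under eq_bigr => x do rewrite fgliftZ fgliftU.
rewrite /cone_simplex; case: ifPn => ys.
  rewrite bd0 add0r (big_fsetD1 y) //= !inE eqxx /= big1_seq ?addr0.
    by rewrite scalerA fsetD1K // sgnD1 // sgn_sq scale1r.
  by move=> x /=; rewrite !inE => /andP[xy _]; rewrite eq_sym xy ys scaler0.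
rewrite /bd fgliftZ fgliftU bd_simplexE big_fsetU1 //= fsetU1K // scalerDr scalerA.
rewrite sgnU1 // sgn_sq scale1r -addrA scaler_sumr -big_split big1_seq ?addr0 //=.
move=> x /= xs; have xy : x != y by apply: contraNneq ys => <-.
rewrite !inE eq_sym (negPf xy) (negPf ys) /= !scalerA.
have -> : (y |` s) `\ x = y |` (s `\ x).
  apply/fsetP => t; rewrite !inE; case: (eqVneq t y) => [->|] //=.
  by rewrite eq_sym xy.
by rewrite -scalerDl sgn_anticomm // scale0r.
Qed.

(* [bd_cone] reduces the claim for [y |` s] to the claim for [s]. *)
Lemma bd_bd c : bd (bd c) = 0.
Proof.
move: c; apply: (eq_freeg (F := fun c => bd (bd c)) (G := fun=> 0)).
- by move=> c1 c2; rewrite !bdD.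
- by move=> c1 c2; rewrite addr0.
elim/fset1U_rect => [|y s0 ys IH]; first by rewrite bdE big_nil bd0.
pose s : {fset T} := s0; rewrite -/s in ys IH *.
have -> : << y |` s >> = sgn y s *: cone y << s >> :> {freeg {fset T} / int}.
  by rewrite /cone fgliftU /cone_simplex (negPf ys) scalerA sgn_sq scale1r.
rewrite /bd !fgliftZ -/(@bd _ T).
have -> : bd (cone y << s >>) = << s >> - cone y (bd << s >>).
  by rewrite -{2}(bd_cone y << s >>) addrK.
rewrite bdB; have := bd_cone y (bd << s >>); rewrite IH /cone fglift0 addr0 => ->.
by rewrite subrr scaler0.
Qed.

Lemma link_cone y c : supported (fun s => y \notin s) c -> link y (cone y c) = c.
Proof.
apply: (eq_supported (F := link y \o cone y) (G := id)) => [c1 c2|//|s ys] /=.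
  by rewrite /link /cone !fgliftD.
rewrite /link /cone fgliftU /cone_simplex (negPf ys) fgliftZ fgliftU /link_simplex.
by rewrite fset1U1 fsetU1K // scalerA sgnU1 // sgn_sq scale1r.
Qed.

Lemma link_eq0 y c : supported (fun s => y \notin s) c -> link y c = 0.
Proof.
apply: (eq_supported (F := link y) (G := fun=> 0)) => [c1 c2|c1 c2|s ys].
- by rewrite /link fgliftD.
- by rewrite addr0.
- by rewrite /link fgliftU /link_simplex (negPf ys).
Qed.

Lemma supported_bd (P Q : set {fset T}) c :
  supported P c -> (forall s x, P s -> x \in s -> Q (s `\ x)) ->
  supported Q (bd c).
Proof.
move=> h PQ; apply: (supported_lift h) => s Ps; rewrite bd_simplexE.
by apply: supported_sum => x xs; apply: supportedZ; apply: supportedU; apply: PQ.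
Qed.

Lemma supported_cone (P Q : set {fset T}) y c :
  supported P c -> (forall s, P s -> y \notin s -> Q (y |` s)) ->
  supported Q (cone y c).
Proof.
move=> h PQ; apply: (supported_lift h) => s Ps; rewrite /cone_simplex.
case: ifPn => ys; first exact: supported0.
by apply: supportedZ; apply: supportedU; apply: PQ.
Qed.

Lemma supported_link (P Q : set {fset T}) y c :
  supported P c -> (forall s, P s -> y \in s -> Q (s `\ y)) ->
  supported Q (link y c).
Proof.
move=> h PQ; apply: (supported_lift h) => s Ps; rewrite /link_simplex.
case: ifPn => ys; last exact: supported0.
by apply: supportedZ; apply: supportedU; apply: PQ.
Qed.

Lemma supported_sub_cone_link (P : set {fset T}) y c : supported P c ->
  supported (fun s => P s /\ y \notin s) (c - cone y (link y c)).
Proof.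
move: c; apply: supported_ind => [|c1 c2 h1 h2|k s Ps].
- by rewrite /cone /link !fglift0 subr0; apply: supported0.
- by rewrite /cone /link !fgliftD opprD addrACA; apply: supportedD.
rewrite /cone /link !fgliftZ -scalerBr; apply: supportedZ.
rewrite !fgliftU /link_simplex; case: ifPn => ys; last first.
  by rewrite fglift0 subr0; apply: supportedU.
rewrite fgliftZ fgliftU /cone_simplex !inE eqxx /= fsetD1K // scalerA.
by rewrite sgnD1 // sgn_sq scale1r subrr; apply: supported0.
Qed.

(** Write [c] as [cone y w + u] with [u] avoiding [y]. In its boundary only [- cone y (bd w)]
    involves [y], and [link y] extracts [- bd w] from it. *)
Lemma bd_link y c : bd c = 0 -> bd (link y c) = 0.
Proof.
set w := link y c => bdc; set u := c - cone y w.
have uN : supported (fun s => y \notin s) u.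
  by apply: (supported_subset (@supported_sub_cone_link _ y _ (supported_self c))) => s [].
have wN : supported (fun s => y \notin s) w.
  by apply: (supported_link (supported_self c)) => s _ _; rewrite !inE eqxx.
have Nbd (z : {freeg {fset T} / int}) : supported (fun s => y \notin s) z ->
    supported (fun s => y \notin s) (bd z).
  by move=> h; apply: (supported_bd h) => s x ys _; rewrite !inE negb_and ys orbT.
have : link y (bd (cone y w + u)) = 0.
  by rewrite /u addrC subrK bdc /link fglift0.
rewrite bdD; have -> : bd (cone y w) = w - cone y (bd w).
  by rewrite -{2}(bd_cone y w) addrK.
have -> : link y (w - cone y (bd w) + bd u) =
    link y w - link y (cone y (bd w)) + link y (bd u).
  by rewrite /link fgliftD fgliftB.
rewrite (link_eq0 wN) (link_cone (Nbd _ wN)) (link_eq0 (Nbd _ uN)).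
by rewrite sub0r addr0 => /eqP; rewrite oppr_eq0 => /eqP.
Qed.

(** The empty simplex stands for the generator of C_{-1}; this reconciles the degree condition on
    0-cycles with [bd]. *)
Lemma bd_vertices c : supported (fun s => #|` s| = 1%N) c ->
  bd c = deg c *: << fset0 >>.
Proof.
apply: (eq_supported (F := @bd _ T) (G := fun c => deg c *: << fset0 >>)).
- exact: bdD.
- by move=> c1 c2; rewrite degD scalerDl.
move=> s /eqP/cardfs1P[x ->]; rewrite bdE big_seq_fset1 degU scale1r fsetDv.
have -> : sgn x [fset x] = 1; last by rewrite scale1r.
rewrite /sgn /pos (_ : [fset t in [fset x] | (t < x)%O] = fset0) ?cardfs0 //.
by apply/fsetP => t; rewrite !inE; case: eqP => // ->; rewrite ltxx.
Qed.

Lemma deg_eq0_bd c : supported (fun s => #|` s| = 1%N) c -> (deg c = 0) <-> (bd c = 0).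
Proof.
move=> h; rewrite bd_vertices //; split => [->|]; first by rewrite scale0r.
move=> /(congr1 (coeff fset0)); rewrite coeffZ coeffU eqxx !mulr1 => ->.
by rewrite coeff0.
Qed.

Lemma cone_bd_simplex y s : y \in s -> cone y (bd << s >>) = << s >>.
Proof.
move=> ys; rewrite -[RHS](bd_cone y) /cone fgliftU /cone_simplex ys.
by rewrite bd0 add0r.
Qed.

End Exterior.

(** * Sets of cardinal at most aleph_m *)

Section Cardinals.
Local Open Scope classical_set_scope.

(* [small 0 X] means that [X] is finite, and [small m.+1 X] that the cardinal
   of [X] is at most aleph_m. *)
Fixpoint small (m : nat) (T : Type) (X : set T) : Prop :=
  if m is m'.+1 then
    exists (I : wotype) (r : T -> I), forall i, small m' [set x | X x /\ (r x <= i)%O]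
  else finite_set X.

Lemma small_subset m (T : Type) (X Y : set T) : X `<=` Y -> small m Y -> small m X.
Proof.
elim: m X Y => [X Y XY|m IH X Y XY [I [r h]]] /=; first exact: sub_finite_set.
by exists I, r => i; apply: IH (h i) => x /= [/XY].
Qed.

Lemma small_S m (T : Type) (X : set T) : small m X -> small m.+1 X.
Proof.
move=> h; exists (fin_ord 1), (fun=> ord0) => i.
by apply: small_subset h => x [].
Qed.

Lemma finite_small m (T : Type) (X : set T) : finite_set X -> small m X.
Proof. by elim: m => // m IH /IH; apply: small_S. Qed.

Lemma small_image m (T U : Type) (f : T -> U) (X : set T) :
  small m X -> small m (f @` X).
Proof.
elim: m X => [X|m IH X [I [r h]]]; first exact: finite_image.
have [[x0 _]|X0] := pselect (X !=set0); last first.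
  by apply: finite_small; rewrite (_ : X = set0) ?image_set0 // -subset0 => x Xx;
    apply: X0; exists x.
have /choice[g gP] : forall u, exists x, (f @` X) u -> X x /\ f x = u.
  move=> u; have [[x Xx <-]|nu] := pselect ((f @` X) u); first by exists x.
  by exists x0.
exists I, (r \o g) => i; apply: small_subset (IH _ (h i)) => u /= [/gP[Xg fg] ru].
by exists (g u).
Qed.

Lemma small_inj m (T U : Type) (f : T -> U) (X : set T) (Y : set U) :
  (forall x y, X x -> X y -> f x = f y -> x = y) -> (forall x, X x -> Y (f x)) ->
  small m Y -> small m X.
Proof.
move=> fI fY sY.
have [[x0 _]|X0] := pselect (X !=set0); last first.
  by apply: finite_small; rewrite (_ : X = set0) // -subset0 => x Xx; apply: X0; exists x.
have /choice[g gP] : forall u, exists x, forall y, X y -> f y = u -> x = y.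
  move=> u; have [[x [Xx <-]]|nu] := pselect (exists x, X x /\ f x = u).
    by exists x => y Xy /esym; apply: fI.
  by exists x0 => y Xy fy; case: nu; exists y.
apply: small_subset (small_image g sY) => x Xx; exists (f x); first exact: fY.
exact: gP.
Qed.

Lemma small_setU1 m (T : Type) (X : set T) x : small m X -> small m (x |` X).
Proof.
elim: m X => [X|m IH X [I [r h]]].
  by rewrite /= finite_setU; split=> //; apply: finite_set1.
exists I, r => i; apply: small_subset (IH _ (h i)) => y [[->|Xy] ry]; first by left.
by right.
Qed.

Lemma lexi_wf (I J : wotype) :
  well_founded (fun x y : (I *lexi[Order.Disp tt tt] J)%type => (x < y)%O).
Proof.
move=> [i j]; elim/(well_founded_ind (@wo_wf I)): i j => i IHi j.
elim/(well_founded_ind (@wo_wf J)): j => j IHj.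
constructor=> -[i' j']; rewrite Order.ProdLexiOrder.ltEprodlexi /=.
rewrite le_eqVlt => /andP[/orP[/eqP->|lti] ltj]; last exact (IHi i' lti j').
by rewrite lexx in ltj; exact (IHj j' ltj).
Qed.

(** Ties in the ranking [r] are broken by an arbitrary well-order of [T]. An initial segment of the
    lexicographic order stays inside a sublevel set of [r]. *)
Lemma small_well_order m (T : choiceType) (X : set T) : small m.+1 X ->
  exists (W : wotype) (f : T -> W), injective f /\
    forall y, small m [set x | X x /\ (f x < f y)%O].
Proof.
move=> [I [r h]]; have [J [g gI]] := wotype_on T.
exists (WOType (@lexi_wf I J)), (fun x => (r x, g x)); split=> [x y [_ /gI]//|y].
apply: small_subset (h (r y)) => x /= [Xx].
by rewrite Order.ProdLexiOrder.ltEprodlexi /= => /andP[].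
Qed.

(* Choice by well-founded recursion: [F a] may depend on the earlier values. *)
Lemma wf_choice (A T : Type) (R : A -> A -> Prop) (Q : A -> set T -> T -> Prop) (t0 : T) :
  well_founded R ->
  exists F : A -> T, forall a, (exists u, Q a (F @` [set b | R b a]) u) ->
    Q a (F @` [set b | R b a]) (F a).
Proof.
move=> wfR.
pose step a (rec : forall b, R b a -> T) : T :=
  if pselect (exists u, Q a [set u | exists b (h : R b a), rec b h = u] u)
  is left e then projT1 (cid e) else t0.
have Feq a : Fix wfR (fun=> T) step a = step a (fun b _ => Fix wfR (fun=> T) step b).
  apply: Fix_eq => x f g fg; suff -> : f = g by [].
  by apply: functional_extensionality_dep => y; apply: functional_extensionality_dep.
exists (Fix wfR (fun=> T) step) => a; rewrite Feq; set F := Fix _ _ _.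
have -> : F @` [set b | R b a] = [set u | exists b (h : R b a), F b = u].
  by apply/seteqP; split=> u [b]; [move=> h <-; exists b, h|move=> [h <-]; exists b].
by rewrite /step; case: pselect => // e _; case: (cid e).
Qed.

(** Transfinite recursion: the images of the predecessors of a point form a [small m] set, which
    cannot exhaust [Y], so a fresh value is always available. *)
Lemma small_embedding m (T U : choiceType) (X : set T) (Y : set U) :
  small m.+1 X -> ~ small m Y ->
  exists f : T -> U, (forall x y, X x -> X y -> f x = f y -> x = y) /\
    forall x, X x -> Y (f x).
Proof.
move=> /small_well_order[W [f [fI fS]]] nY.
have [y0 _] : Y !=set0.
  have [//|Y0] := pselect (Y !=set0); case: nY; apply: finite_small.
  by rewrite (_ : Y = set0) // -subset0 => y Yy; apply: Y0; exists y.
have wfR : well_founded (fun x y => X x /\ (f x < f y)%O).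
  move=> x; have [w] : exists w, w = f x by exists (f x).
  elim/(well_founded_ind (@wo_wf W)): w x => w IH x xw; constructor=> y [_ yx].
  by apply: (IH (f y)) => //; rewrite xw.
have [F FP] := @wf_choice T U _ (fun a S u => Y u /\ ~ S u) y0 wfR.
have {}FP y : Y (F y) /\ ~ (F @` [set x | X x /\ (f x < f y)%O]) (F y).
  apply: FP; apply: contrapT => nu; apply: nY.
  apply: small_subset (small_image F (fS y)) => u Yu.
  by apply: contrapT => nFu; apply: nu; exists u.
exists F; split=> [x y Xx Xy Fxy|x _]; last by case: (FP x).
case: (ltgtP (f x) (f y)) => [lt|lt|/fI//].
  by case: (FP y) => _ []; exists x.
by case: (FP x) => _ []; exists y.
Qed.

Lemma segment_wotype (g : wotype) (x : g) :
  exists (b : wotype) (f : b -> g), {mono f : y z / (y < z)%O} /\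
    range f = [set y | (y < x)%O].
Proof.
pose S := {y : g | (y < x)%O}.
pose R : rel S := fun a b => (sval a <= sval b)%O.
have rR : reflexive R by move=> a; apply: lexx.
have aR : antisymmetric R by move=> a b /le_anti/val_inj.
have trR : transitive R by move=> a b c; apply: le_trans.
have tR : total R by move=> a b; apply: le_total.
pose S' : orderType _ := order_of rR aR trR tR.
have vm : {mono (fun a : S' => sval (a : S)) : a b / (a < b)%O}.
  by move=> a b; rewrite !lt_def (inj_eq val_inj).
have wf : well_founded (fun a b : S' => (a < b)%O).
  move=> a; have [w] : exists w, w = sval (a : S) by exists (sval (a : S)).
  elim/(well_founded_ind (@wo_wf g)): w a => w IH a aw; constructor=> b ba.
  by apply: (IH (sval (b : S))) => //; rewrite aw vm.
exists (WOType wf), (fun a : S' => sval (a : S)); split=> //.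
apply/seteqP; split=> y /=; first by move=> [[z zx] _ <-].
by move=> yx; exists (exist _ y yx).
Qed.

Lemma small_segment_le m (k : wotype) (x : k) :
  small m [set y | (y < x)%O] -> small m [set y | (y <= x)%O].
Proof.
move=> /(small_setU1 x); apply: small_subset => y /=.
by rewrite le_eqVlt => /orP[/eqP|]; [left|right].
Qed.

(** By minimality, a proper segment of omega_(m+1) injects into omega_m, which its own order ranks
    suitably. If the whole ordinal were small, [small_embedding] would also inject it into
    omega_m. *)
Lemma is_omega_small m (k : wotype) : is_omega m k ->
  (forall x : k, small m [set y | (y < x)%O]) /\ ~ small m [set: k].
Proof.
elim: m k => [k [kinf kmin]|m IH k /= [k' /IH[k's k'ns] [kn kmin]]]; split=> //.
- move=> x; have [b [f [fm fr]]] := segment_wotype x.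
  suff h : small 0 [set: b] by apply: small_subset (small_image f h); rewrite fr.
  by apply: contrapT => binf; case: (kmin b) => //; exists x, f.
- move=> x; have [b [f [fm fr]]] := segment_wotype x.
  suff h : small m.+1 [set: b] by apply: small_subset (small_image f h); rewrite fr.
  have [h hI] : exists h : b -> k', injective h.
    by apply: contrapT => nh; case: (kmin b) => //; exists x, f.
  exists k', h => i; apply: (small_inj (f := h)) (small_segment_le (k's i)).
    by move=> y z _ _; apply: hI.
  by move=> y [].
- move=> ks; apply: kn; have [h [hI _]] := small_embedding ks k'ns.
  by exists h => x y; apply: hI.
Qed.

Lemma is_omega_small_le m (k : wotype) (x : k) : is_omega m k ->
  small m [set y | (y <= x)%O].
Proof. by move=> /is_omega_small[/(_ x)/small_segment_le]. Qed.

Lemma is_omega_smallS m (k : wotype) : is_omega m k -> small m.+1 [set: k].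
Proof.
by move=> om; exists k, id => i; apply: small_subset (is_omega_small_le i om) => x [].
Qed.

Lemma small_embedding_omega m (k : wotype) (T : choiceType) (X : set T) :
  is_omega m k -> small m.+1 X ->
  exists f : T -> k, forall x y, X x -> X y -> f x = f y -> x = y.
Proof.
by move=> /is_omega_small[_ kn] sX; have [f [fI _]] := small_embedding sX kn; exists f.
Qed.

(** Both factors embed into omega_m, where pairs are ranked by their maximum: those of rank at most
    [i] lie in the square of a segment, to which induction applies. *)
Lemma small_setX m (T U : choiceType) (X : set T) (Y : set U) :
  small m X -> small m Y -> small m (X `*` Y).
Proof.
elim: m T U X Y => [|m IH] T U X Y sX sY; first exact: finite_setX.
have [k om] := omega_exists m.
have [f fI] := small_embedding_omega om sX.
have [g gI] := small_embedding_omega om sY.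
apply: (@small_inj _ _ _ (fun p => (f p.1, g p.2)) _ setT) => //.
  by move=> [x y] [x' y'] [Xx Yy] [Xx' Yy'] /= [/fI-> // /gI->].
exists k, (fun p : k * k => Order.max p.1 p.2) => i.
apply: small_subset (IH k k _ _ (is_omega_small_le i om) (is_omega_small_le i om)).
by move=> [x y] /= [_]; rewrite ge_max => /andP[].
Qed.

(** In the infinite case a point is coded by an index [j] whose [A j] contains it, together with its
    image in omega_m under an embedding of [A j]. *)
Lemma small_bigcup m (J T : choiceType) (D : set J) (A : J -> set T) :
  small m D -> (forall j, D j -> small m (A j)) -> small m (\bigcup_(j in D) A j).
Proof.
case: m => [|m] sD sA; first exact: bigcup_finite.
have [k om] := omega_exists m.
have /choice[g gI] : forall j, exists g : T -> k,
    D j -> forall x y, A j x -> A j y -> g x = g y -> x = y.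
  move=> j; have [/sA/(small_embedding_omega om)[g gI]|nD] := pselect (D j).
    by exists g.
  have [[x0 _]|nk] := pselect ([set: k] !=set0); first by exists (fun=> x0).
  case: (is_omega_small om) => _ []; apply: finite_small.
  by rewrite (_ : setT = set0) // -subset0 => x _; apply: nk; exists x.
have [[j0 _]|D0] := pselect (D !=set0); last first.
  apply: finite_small; rewrite (_ : \bigcup_(j in D) A j = set0) // -subset0.
  by move=> x [j Dj _]; apply: D0; exists j.
have /choice[h hP] : forall x, exists j, (\bigcup_(j in D) A j) x -> D j /\ A j x.
  move=> x; have [[j Dj Ax]|nx] := pselect ((\bigcup_(j in D) A j) x).
    by exists j.
  by exists j0.
apply: (@small_inj _ _ _ (fun x => (h x, g (h x) x)) _ (D `*` setT)).
- move=> x y /hP[Dx Ax] /hP[_ Ay] [hxy gxy]; rewrite -hxy in Ay gxy.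
  exact: gI Dx _ _ Ax Ay gxy.
- by move=> x /hP[].
- exact/small_setX/(is_omega_smallS om).
Qed.

Lemma small_setU m (T : choiceType) (X Y : set T) :
  small m X -> small m Y -> small m (X `|` Y).
Proof.
move=> sX sY; rewrite (_ : X `|` Y = \bigcup_(b in [set: bool]) (if b then X else Y)).
  apply: small_bigcup => [|[]//]; exact/finite_small/finite_finset.
apply/seteqP; split=> x; first by move=> [Xx|Yx]; [exists true|exists false].
by move=> [[] _]; [left|right].
Qed.

Lemma small_nat m : small m.+1 [set: nat].
Proof.
have wf_nat : well_founded (fun x y : nat => (x < y)%O).
  by move=> n; elim/ltn_ind: n => n IH; constructor=> y; rewrite ltEnat; apply: IH.
elim: m => [|m]; last exact: small_S.
exists (WOType wf_nat), id => i; apply: sub_finite_set (finite_II i.+1) => n [_].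
by rewrite leEnat.
Qed.

Lemma small_seq m (T : choiceType) (X : set T) : small m.+1 X ->
  small m.+1 [set s : seq T | forall x, x \in s -> X x].
Proof.
move=> sX.
have sn n : small m.+1 [set s : seq T | size s = n /\ forall x, x \in s -> X x].
  elim: n => [|n IH].
    apply: finite_small; apply: sub_finite_set (finite_set1 [::]) => s /= [].
    by case: s.
  apply: small_subset (small_image (fun p => p.1 :: p.2) (small_setX sX IH)).
  move=> [|x s] [] //= [ss] h; exists (x, s) => //=.
  split; first by apply: h; rewrite mem_head.
  by split=> // y ys; apply: h; rewrite inE ys orbT.
apply: small_subset (small_bigcup (small_nat m) (fun n _ => sn n)) => s hs.
by exists (size s).
Qed.

End Cardinals.

(** * Directed sets closed under a finitary operation *)

Section Closure.
Local Open Scope classical_set_scope.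

Lemma exists_common_index (T : choiceType) (d : Order.disp_t) (I : orderType d)
    (C : I -> set T) (i0 : I) (s : seq T) :
  (forall i j, (i <= j)%O -> C i `<=` C j) ->
  (forall x, x \in s -> exists i, C i x) -> exists i, forall x, x \in s -> C i x.
Proof.
move=> Cm; elim: s => [_|x s IH h]; first by exists i0.
have [|i iP] := IH; first by move=> y ys; apply: h; rewrite inE ys orbT.
have [|j jP] := h x; first by rewrite mem_head.
exists (Order.max i j) => y; rewrite inE => /orP[/eqP->|/iP].
  by apply: Cm jP; rewrite le_max lexx orbT.
by apply: Cm; rewrite le_max lexx.
Qed.

Variable T : choiceType.
Implicit Types (A C : set T) (F : {fset T} -> set T).

Definition closed_under F C :=
  forall s : {fset T}, [set` s] `<=` C -> F s `<=` C.

Definition closure F A : set T :=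
  [set x | forall C, A `<=` C -> closed_under F C -> C x].

Lemma closure_closed F A : closed_under F (closure F A).
Proof.
move=> s sA x Fx C sAC Cc; by apply: (Cc s _ x Fx) => y ys; apply: sA.
Qed.

Lemma sub_closure F A : A `<=` closure F A.
Proof. by move=> x Ax C sAC _; apply: sAC. Qed.

Lemma closure_min F A C : A `<=` C -> closed_under F C -> closure F A `<=` C.
Proof. by move=> sAC Cc x; apply. Qed.

Lemma closureS F A C : A `<=` C -> closure F A `<=` closure F C.
Proof.
move=> sAC; apply: closure_min; last exact: closure_closed.
exact: subset_trans sAC (@sub_closure _ _).
Qed.

Lemma closed_under_bigcup F (d : Order.disp_t) (I : orderType d) (C : I -> set T) (i0 : I) :
  (forall i j, (i <= j)%O -> C i `<=` C j) -> (forall i, closed_under F (C i)) ->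
  closed_under F (\bigcup_i C i).
Proof.
move=> Cm Cc s sC; have [|i iP] := @exists_common_index T _ I C i0 s Cm.
  by move=> x xs; have [i _ Cx] := sC x xs; exists i.
by move=> x Fx; exists i => //; apply: (Cc i s).
Qed.

(** Arguments are finite, so omega rounds of adding values suffice. Each round is indexed by finite
    lists, of which there are at most aleph_m. *)
Lemma small_closure m F A : (forall s, finite_set (F s)) -> small m.+1 A ->
  small m.+1 (closure F A).
Proof.
move=> Ffin sA.
pose next B := B `|` \bigcup_(s in [set s : seq T | forall x, x \in s -> B x])
  F [fset x in s]%fset.
pose B n := iter n next A.
have Bm i j : (i <= j)%O -> B i `<=` B j.
  rewrite leEnat => /subnK <-; elim: (j - i)%N => // n IH.
  by rewrite addSn; apply: subset_trans IH _ => x; left.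
have sB n : small m.+1 (B n).
  elim: n => // n IH; apply: small_setU => //.
  by apply: small_bigcup (small_seq IH) _ => s _; apply: finite_small.
apply: (@small_subset _ _ _ (\bigcup_n B n)); last exact: small_bigcup (small_nat m) _.
apply: closure_min; first by move=> x Ax; exists 0%N.
move=> s sB' x Fx.
have [|n nP] := @exists_common_index T _ nat B 0%N s Bm.
  by move=> y ys; have [n _ By] := sB' y ys; exists n.
exists n.+1 => //; right; exists (enum_fset s); first exact: nP.
by apply: (eq_ind s (fun t => F t x) Fx); apply/fsetP => y; rewrite !inE.
Qed.

End Closure.

Section Directed.
Local Open Scope classical_set_scope.

(** Since [small m] means cardinal below aleph_m, this is strict aleph_m-directedness. The empty set
    and the singletons make [X] nonempty and without maximum. *)
Definition directed (m : nat) (d : Order.disp_t) (T : orderType d) (X : set T) :=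
  forall A, A `<=` X -> small m A -> exists2 x, X x & forall a, A a -> (a < x)%O.

(** This is the regularity of omega_m: the segments up to the points of an unbounded [A] would cover
    [k] by a small union of small sets. *)
Lemma is_omega_directed m (k : wotype) : is_omega m k -> directed m [set: k].
Proof.
move=> om A _ sA; apply: contrapT => nx; case: (is_omega_small om) => _; apply.
apply: small_subset (small_bigcup sA (fun a _ => is_omega_small_le a om)) => x _.
apply: contrapT => nA; apply: nx; exists x => // a Aa.
by rewrite ltNge; apply/negP => xa; apply: nA; exists a.
Qed.

(** A chain of length omega_m is chosen in [X], each term strictly above the closure of the earlier
    ones; [N] is the closure of the chain. By regularity a [small m] subset of [N] falls within one
    stage, and the term chosen at that stage bounds it. *)
Lemma directed_closed_subset m (d : Order.disp_t) (T : orderType d) (X : set T)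
    (F : {fset T} -> set T) :
  directed m.+1 X -> closed_under F X -> (forall s, finite_set (F s)) ->
  exists N, [/\ N `<=` X, closed_under F N, small m.+1 N & directed m N].
Proof.
move=> dX cX Ffin; have [k om] := omega_exists m; have dk := is_omega_directed om.
have [x0 _ _] : exists2 x, X x & forall a, set0 a -> (a < x)%O.
  by apply: dX => //; apply: finite_small.
have [i0 _ _] : exists2 i : k, setT i & forall a, set0 a -> (a < i)%O.
  by apply: dk => //; apply: finite_small.
pose Q (i : k) S u := X u /\ forall a, closure F S a -> (a < u)%O.
have [f fP] := wf_choice Q x0 (@wo_wf k).
pose C i := closure F (f @` [set j | (j < i)%O]).
have {}fP i : Q i (f @` [set j | (j < i)%O]) (f i).
  elim/(well_founded_ind (@wo_wf k)): i => i IH; apply: fP.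
  have [| |u Xu uP] := dX (C i).
  - by apply: closure_min => // _ [j /= ji <-]; case: (IH j ji).
  (* The earlier terms form a [small m] set, but the closure is only [small m.+1]: closing a finite
     set may give a countable one. Hence [directed m.+1] for [X]. *)
  - apply: small_closure => //; apply: small_S; apply: small_image.
    exact: (is_omega_small om).1.
  - by exists u.
have Cm i j : (i <= j)%O -> C i `<=` C j.
  move=> ij; apply: closureS => _ [l /= li <-]; exists l => //=.
  exact: lt_le_trans li ij.
exists (closure F (range f)); split.
- by apply: closure_min => // _ [i _ <-]; case: (fP i).
- exact: closure_closed.
- by apply: small_closure => //; apply/small_image/is_omega_smallS.
move=> A AN sA.
have /choice[h hP] : forall a, exists i, A a -> C i a.
  move=> a; have [Aa|] := pselect (A a); last by exists i0.
  suff [i _ Ca] : (\bigcup_i C i) a by exists i.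
  apply: (closure_min _ _ (AN a Aa)); last first.
    by apply: closed_under_bigcup => // i; apply: closure_closed.
  move=> _ [j _ <-]; have [//||i _ ij] := dk [set j].
    by apply: finite_small; apply: finite_set1.
  by exists i => //; apply: sub_closure; exists j => //=; apply: ij.
have [//||i _ iP] := dk (h @` A); first exact: small_image.
exists (f i); first by apply: sub_closure; exists i.
move=> a Aa; apply: (fP i).2; apply: Cm (hP a Aa); apply: ltW.
by apply: iP; exists a.
Qed.

End Directed.

(** * Retractions onto cycles *)

Lemma subr_eq_sub (V : zmodType) (a b a' b' : V) :
  (a' - b' = a - b -> a - a' = b - b')%R.
Proof.
move=> e; have -> : a' = (a - b + b')%R by rewrite -e subrK.
by rewrite opprD opprB addrA [(a + _)%R]addrC subrK.
Qed.

Section Retraction.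
Variables (d : Order.disp_t) (T : orderType d).
Implicit Types (s t : {fset T}) (x y : T) (c : {freeg {fset T} / int}) (X N : set T).
Local Open Scope fset_scope.
Local Open Scope classical_set_scope.
Local Open Scope ring_scope.

Definition simplices n X : set {fset T} :=
  [set s | #|` s| = n.+1 /\ [set` s] `<=` X].

Definition lower_bounds s : set T := [set a | forall x, x \in s -> (a <= x)%O].

(** For nonempty [s] and [t] the second clause compares minima; lower bounds handle all tails at
    once and allow an empty [t]. *)
Definition above X s : set {fset T} :=
  [set t : {fset T} | [set` t] `<=` X /\ lower_bounds s `<=` lower_bounds t].

(* A linear retraction of the [n]-chains on [X] onto the [n]-cycles which maps,
   for every [a], the chains on [X] above [a] to chains on [X] above [a]. *)
Definition cycle_retraction n X (q : {fset T} -> {freeg {fset T} / int}) :=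
  [/\ forall s, simplices n X s -> supported (above X s) (q s),
      forall s, simplices n X s -> bd (q s) = 0 &
      forall c, supported (simplices n X) c -> bd c = 0 -> fglift q c = c].

Definition vertices c : set T := [set x | exists2 t, t \in dom c & x \in t].

Lemma finite_vertices c : finite_set (vertices c).
Proof.
rewrite (_ : vertices c = \bigcup_(t in [set` dom c]) [set` t]).
  by apply: bigcup_finite => [|t _]; [exact: finite_seq|exact: finite_fset].
by apply/seteqP; split=> x [t tc xt]; exists t.
Qed.

Lemma bd_fset0 : bd << fset0 >> = 0 :> {freeg {fset T} / int}.
Proof. by rewrite bdE big_nil. Qed.

Lemma bd_fset1 x : bd << [fset x] >> = << fset0 >> :> {freeg {fset T} / int}.
Proof.
rewrite bd_vertices ?degU ?scale1r //.
by move=> t; rewrite domU1 inE => /eqP->; rewrite cardfs1.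
Qed.

Lemma simplices1 x X : X x -> simplices 0 X [fset x].
Proof.
by move=> Xx; split; rewrite ?cardfs1 // => y /=; rewrite inE => /eqP->.
Qed.

Lemma no_cycle_retraction0 X q : directed 0 X -> ~ cycle_retraction 0 X q.
Proof.
move=> dX [q1 q2 q3].
have [x Xx _] : exists2 x, X x & forall a, set0 a -> (a < x)%O.
  by apply: dX => //; apply: finite_set0.
pose h y : {freeg {fset T} / int} := << [fset y] >> - q [fset y].
have hh y : X y -> h x = h y.
  move=> Xy; have : fglift q (<< [fset x] >> - << [fset y] >>) =
      << [fset x] >> - << [fset y] >>.
    apply: q3; last by rewrite bdB !bd_fset1 subrr.
    by apply: supportedB; apply: supportedU; apply: simplices1.
  by rewrite fgliftB !fgliftU => /subr_eq_sub.
have hs y : X y -> supported (above X [fset y]) (h y).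
  move=> Xy; apply: supportedB; last by apply: q1; apply: simplices1.
  by apply: supportedU; split=> // z /=; rewrite inE => /eqP->.
have [y Xy yP] : exists2 y, X y & forall a, vertices (h x) a -> (a < y)%O.
  apply: dX; last exact: finite_vertices.
  by move=> a [t /(hs x Xx)[tX _] at_]; apply: tX.
have : bd (h x) = 0.
  apply: (@eq_supported _ _ (@bd _ T) (fun=> 0) [set fset0]).
  - exact: bdD.
  - by move=> c1 c2; rewrite addr0.
  - by move=> _ ->; rewrite bd_fset0.
  move=> t tx; apply/eqP; rewrite -[_ == _]negbK; apply/negP => /fset0Pn[v vt].
  have := yP v; rewrite ltNge => /(_ (ex_intro2 _ _ t tx vt))/negP; apply.
  rewrite (hh y Xy) in tx; have [_ tb] := hs y Xy t tx.
  by apply: (tb y) vt => z; rewrite inE => /eqP->.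
rewrite /h bdB bd_fset1 q2 ?subr0; last exact: simplices1.
by move/eqP; rewrite freegU_eq0.
Qed.

Definition restrict_simplex N t : {freeg {fset T} / int} :=
  if `[< [set` t] `<=` N >] then << t >> else 0.

(* If [h := 1 - q], the new retraction is [bd] of the part of [h (b * c)] on [N]:
   a cycle [c] on [N] is the boundary both of [b * c] and of some chain [e] on
   [N], so [h (b * c) = h e] is already supported on [N]. *)
Lemma cycle_retraction_step n X N q b x0 :
  cycle_retraction n.+1 X q -> N `<=` X -> N x0 ->
  (forall s, simplices n.+1 N s -> supported (fun t => [set` t] `<=` N) (q s)) ->
  X b -> (forall x, N x -> (x < b)%O) ->
  exists q', cycle_retraction n N q'.
Proof.
move=> [q1 q2 q3] NX Nx0 qN Xb Nb.
have coneX y c : X y -> supported (simplices n N) c ->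
    supported (simplices n.+1 X) (cone y c).
  move=> Xy cN; apply: (supported_cone cN) => s [s1 s2] ys.
  split; first by rewrite cardfsU1 ys s1.
  by move=> z /=; rewrite !inE => /orP[/eqP->//|/s2/NX].
exists (fun s => bd (fglift (restrict_simplex N)
  (cone b << s >> - fglift q (cone b << s >>)))); split=> [s Ns|s _|c cN bdc].
- have [s1 s2] := Ns.
  have bs : b \notin s by apply/negP => /s2/Nb; rewrite ltxx.
  have bsL : above X s (b |` s)%fset.
    split=> [z /=|a sa z]; rewrite !inE => /orP[/eqP->//|zs].
    + exact/NX/s2.
    + have /fset0Pn[x xs] : s != fset0 by rewrite -cardfs_gt0 s1.
      by apply: le_trans (sa x xs) _; apply/ltW/Nb/s2.
    + exact: sa.
  have bsX : simplices n.+1 X (b |` s)%fset.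
    by split; [rewrite cardfsU1 bs s1|case: bsL].
  have csL : supported (above X s) (cone b << s >> - fglift q (cone b << s >>)).
    rewrite /cone fgliftU /cone_simplex (negPf bs) fgliftZ fgliftU -scalerBr.
    apply: supportedZ; apply: supportedB; first exact: supportedU.
    apply: (supported_subset (q1 _ bsX)) => t [tX tb]; split=> // a sa.
    by apply: tb; apply: bsL.2.
  have : supported (above N s) (fglift (restrict_simplex N)
      (cone b << s >> - fglift q (cone b << s >>))).
    apply: (supported_lift csL) => t [_ tb]; rewrite /restrict_simplex.
    case: asboolP => tN; last exact: supported0.
    exact: supportedU.
  move=> h; apply: (supported_bd h) => t x [tN tb] _; split=> [z|a sa z] /=.
    by rewrite !inE => /andP[_]; apply: tN.
  by rewrite !inE => /andP[_]; apply: tb.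
- exact: bd_bd.
have -> : fglift (fun s => bd (fglift (restrict_simplex N)
      (cone b << s >> - fglift q (cone b << s >>)))) c =
    bd (fglift (restrict_simplex N) (cone b c - fglift q (cone b c))).
  move: c {cN bdc}; apply: (eq_freeg (G := fun c =>
    bd (fglift (restrict_simplex N) (cone b c - fglift q (cone b c))))) => [|c1 c2|s].
  - exact: fgliftD.
  - have -> : cone b (c1 + c2) = cone b c1 + cone b c2 by rewrite /cone fgliftD.
    by rewrite (fgliftD q) opprD addrACA fgliftD bdD.
  - by rewrite fgliftU.
have bdcone y : bd (cone y c) = c.
  by rewrite -[RHS](bd_cone y) bdc /cone fglift0 addr0.
have Xx0 := NX _ Nx0.
(* The apex is an arbitrary vertex of [N]: what counts is that [e] stays on [N] and has boundary
   [c]. *)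
pose e := cone x0 c.
have eN : supported (simplices n.+1 N) e.
  apply: (supported_cone cN) => s [s1 s2] ys; split; first by rewrite cardfsU1 ys s1.
  by move=> z /=; rewrite !inE => /orP[/eqP->//|/s2].
have -> : cone b c - fglift q (cone b c) = e - fglift q e.
  have : fglift q (cone b c - e) = cone b c - e.
    apply: q3; first by apply: supportedB; apply: coneX.
    by rewrite bdB !bdcone subrr.
  by rewrite fgliftB => /subr_eq_sub.
have eqN : supported (fun t => [set` t] `<=` N) (e - fglift q e).
  apply: supportedB; first by apply: (supported_subset eN) => t [].
  exact: (supported_lift eN).
have -> : fglift (restrict_simplex N) (e - fglift q e) = e - fglift q e.
  move: eqN; apply: (eq_supported (F := fglift (restrict_simplex N)) (G := id)) => //.
    exact: fgliftD.
  by move=> s sN; rewrite fgliftU /restrict_simplex; case: asboolP.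
rewrite bdB bdcone.
suff -> : bd (fglift q e) = 0 by rewrite subr0.
have := coneX _ _ Xx0 cN.
apply: (eq_supported (F := fun c => bd (fglift q c)) (G := fun=> 0)) => [c1 c2|c1 c2|s sX].
- by rewrite fgliftD bdD.
- by rewrite addr0.
- by rewrite fgliftU q2.
Qed.

(** Each descent to a smaller set [N] costs one dimension and one degree of directedness, so both
    reach zero together. *)
Lemma no_cycle_retraction n X q : directed n X -> ~ cycle_retraction n X q.
Proof.
elim: n X q => [|n IH] X q dX rq; first exact: no_cycle_retraction0 rq.
have [q1 _ _] := rq.
(* The size test discards the simplices on which nothing is known about [q]; without it [X] might
   fail to be closed under [F]. *)
pose F s : set T := [set x | #|` s| = n.+2 /\ vertices (q s) x].
have [|s|N [NX cN sN dN]] := directed_closed_subset (F := F) dX.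
- by move=> s sX x [s1 [t tq xt]]; have [tX _] := q1 s (conj s1 sX) t tq; apply: tX.
- by apply: sub_finite_set (finite_vertices (q s)) => x [].
have [b Xb Nb] := dX N NX sN.
have [x0 Nx0 _] : exists2 x, N x & forall a, set0 a -> (a < x)%O.
  by apply: dN => //; apply: finite_small; apply: finite_set0.
have [|q' /(IH _ _ dN)//] := cycle_retraction_step rq NX Nx0 _ Xb Nb.
by move=> s [s1 s2] t ts x xt; apply: (cN s s2); split=> //; exists t.
Qed.

End Retraction.

(** * Tail bases *)

Lemma finite_set_argmax (T : choiceType) (d : Order.disp_t) (W : orderType d)
    (f : T -> W) (A : set T) : finite_set A -> (A !=set0)%classic ->
  exists2 y, A y & forall x, A x -> (f x <= f y)%O.
Proof.
move=> /finite_seqP[s ->]; elim: s => [[x]//|x [|x' s] IH _].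
  by exists x => [|z] /=; rewrite inE // => /eqP->.
have [|y ys yP] := IH; first by exists x'; rewrite /= mem_head.
case: (leP (f x) (f y)) => [xy|/ltW yx].
  exists y => [|z]; rewrite /= inE; first by rewrite [y \in _]ys orbT.
  by move=> /orP[/eqP->//|]; apply: yP.
exists x => [|z]; rewrite /= inE ?eqxx // => /orP[/eqP->//|zs].
exact: le_trans (yP z zs) yx.
Qed.

Section TailBasis.
Variables (d : Order.disp_t) (T : orderType d).
Implicit Types (s t : {fset T}) (x y : T) (c z : {freeg {fset T} / int}) (X : set T).
Local Open Scope fset_scope.
Local Open Scope ring_scope.

Definition faces_above n X a : set {fset T} :=
  [set s : {fset T} | [/\ #|` s| = n, [set` s] `<=` X & lower_bounds s a]]%classic.

(* The boundaries of the members of [H] above [a] form a basis of the augmented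
   [n.-1]-cycles of the full simplex on the part of [X] above [a]; for [n = 0]
   the group of (-1)-cycles is [Z] unless that part is empty. *)
Definition tail_basis n X (H : set {fset T}) :=
  [/\ forall s, H s -> simplices n X s,
      forall c, supported H c -> bd c = 0 -> c = 0 &
      forall a z, (exists2 x, X x & (a <= x)%O) ->
        supported (faces_above n X a) z -> bd z = 0 ->
        exists2 c, supported (fun s => H s /\ lower_bounds s a) c & bd c = z].

(** The maximum of [X] lies in every nonempty tail, and its boundary is the empty simplex, which
    generates the (-1)-chains. *)
Lemma tail_basis0 X : finite_set X -> exists H, tail_basis 0 X H.
Proof.
move=> Xfin; have [X0|X0] := pselect (X !=set0)%classic; last first.
  exists (fun=> False); split=> // [c /supported_eq0//|a z [x Xx]].
  by case: X0; exists x.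
have [m Xm mP] := finite_set_argmax id Xfin X0.
have cE (t : {fset T}) c : supported (fun s => s = t) c -> c = deg c *: << t >>.
  apply: (eq_supported (F := id) (G := fun c => deg c *: << t >>)) => //.
    by move=> c1 c2; rewrite degD scalerDl.
  by move=> _ ->; rewrite degU scale1r.
exists (fun s => s = [fset m]); split.
- by move=> _ ->; apply: simplices1.
- move=> c h; have -> := cE _ _ h; rewrite /bd fgliftZ -/(bd _).
  rewrite bd_fset1 => /(congr1 (coeff fset0)); rewrite coeffZ coeffU eqxx coeff0 !mulr1 => ->.
  by rewrite scale0r.
- move=> a z [x Xx ax] h _; exists (deg z *: << [fset m] >>).
    apply: supportedZ; apply: supportedU; split=> // y; rewrite inE => /eqP->.
    exact: le_trans ax (mP x Xx).
  rewrite /bd fgliftZ -/(bd _) bd_fset1 -cE //.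
  by apply: (supported_subset h) => s [/cardfs0_eq].
Qed.

Lemma vertices_neq0 n c : supported (fun s => #|` s| = n.+1) c -> c != 0 ->
  (vertices c !=set0)%classic.
Proof.
move=> h; rewrite -dom_eq0; case E: (dom c) => [//|t r] _.
have td : t \in dom c by rewrite E mem_head.
have /fset0Pn[x xt] : t != fset0 by rewrite -cardfs_gt0 (h t td).
by exists x, t.
Qed.

(** * The inductive step for tail bases *)

Section Step.
Variables (n : nat) (X : set T) (W : wotype) (f : T -> W) (H_ : T -> set {fset T}).
Hypothesis f_inj : injective f.

Let seg y : set T := [set x | X x /\ (f x < f y)%O]%classic.

Hypothesis H_basis : forall y, tail_basis n (seg y) (H_ y).

Let H : set {fset T} := fun s => exists y, [/\ X y, y \in s & H_ y (s `\ y)].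

Lemma step_simplices s : H s -> simplices n.+1 X s.
Proof.
move=> [y [Xy ys hs]]; have [h1 _ _] := H_basis y; have [s1 s2] := h1 _ hs.
split; first by rewrite (cardfsD1 y) ys s1.
move=> x /= xs; case: (eqVneq x y) => [->//|xy].
by have [] : seg y x by apply: s2; rewrite /= !inE xy.
Qed.

(** Let [y] be the [f]-largest vertex of [c]. A simplex of [c] through [y] can belong to [H] only on
    account of [y], so the link at [y] is a cycle in the span of [H_ y]. It vanishes by freeness,
    although [y] occurs in [c]. *)
Lemma step_free c : supported H c -> bd c = 0 -> c = 0.
Proof.
move=> cH bdc; apply/eqP; apply: contraT => c0.
have c1 : supported (fun s => #|` s| = n.+2) c.
  by apply: (supported_subset cH) => s /step_simplices[].
have [y [t tc yt] yP] := finite_set_argmax f (finite_vertices c) (vertices_neq0 c1 c0).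
have w0 : link y c = 0.
  have [_ h2 _] := H_basis y; apply: h2; last exact: bd_link.
  apply: (supported_link (supported_self c)) => s sc ys.
  have [y' [Xy' y's hs]] := cH s sc.
  suff <- : y' = y by [].
  apply/eqP; apply: contraT => y'y; have [h1 _ _] := H_basis y'.
  have [_ /(_ y)] := h1 _ hs; rewrite /= !inE eq_sym y'y ys => /(_ isT)[_].
  by rewrite ltNge yP //; exists s.
have := @supported_sub_cone_link _ _ _ y _ (supported_self c).
by rewrite w0 /cone fglift0 subr0 => /(_ t tc)[_]; rewrite yt.
Qed.

(** Transfinite induction on the [f]-largest vertex [y]. The link at [y] is a cycle below [y],
    filled by some [v] in the span of [H_ y]. Adding [bd (cone y v)] removes all simplices through
    [y], and [cone y v] lies in the span of [H]. *)
Lemma step_fill a z : supported (faces_above n.+1 X a) z -> bd z = 0 ->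
  exists2 c, supported (fun s => H s /\ lower_bounds s a) c & bd c = z.
Proof.
pose bounded y s := faces_above n.+1 X a s /\ forall x, x \in s -> (f x <= f y)%O.
pose fillable z := exists2 c, supported (fun s => H s /\ lower_bounds s a) c & bd c = z.
have top z0 : supported (faces_above n.+1 X a) z0 ->
    (forall y, vertices z0 y -> supported (bounded y) z0 -> fillable z0) -> fillable z0.
  move=> h hy; have [->|z00] := eqVneq z0 0.
    by exists 0; [exact: supported0|exact: bd0].
  have h1 : supported (fun s => #|` s| = n.+1) z0.
    by apply: (supported_subset h) => s [].
  have [y yz yP] := finite_set_argmax f (finite_vertices z0) (vertices_neq0 h1 z00).
  apply: (hy y yz) => s sz; split; first exact: h.
  by move=> x xs; apply: yP; exists s.
suff main w y z0 : f y = w -> X y -> (a <= y)%O -> supported (bounded y) z0 ->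
    bd z0 = 0 -> fillable z0.
  move=> h bdz; apply: top => // y [t tz yt] hb.
  by have [_ tX ta] := h t tz; apply: (main (f y) y) => //; [exact: tX|exact: ta].
elim/(well_founded_ind (@wo_wf W)): w y z0 => w IH y z0 fyw Xy ay hb bdz.
pose u := z0 - cone y (link y z0).
have hu : supported (fun s => bounded y s /\ y \notin s) u.
  exact: supported_sub_cone_link.
have zE : z0 = u + cone y (link y z0) by rewrite subrK.
have bdlink := bd_link y bdz.
(* When no vertex of [seg y] is above [a], the basis below [y] offers no filling. But then [z0]
   involves no vertex other than [y] and, being a cycle, is zero. *)
have [nonempty|empty] := pselect (exists2 x, seg y x & (a <= x)%O); last first.
  have u0 : u = 0.
    apply: supported_eq0; apply: (supported_subset hu) => s [[[s1 s2 sa] sb] ys].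
    have /fset0Pn[x xs] : s != fset0 by rewrite -cardfs_gt0 s1.
    apply: empty; exists x; last exact: sa.
    split; first exact: s2.
    rewrite lt_neqAle sb // andbT; apply: contraNneq ys => /f_inj <-.
    exact: xs.
  have l0 : link y z0 = 0.
    have zc : cone y (link y z0) = z0 by rewrite {2}zE u0 add0r.
    by have := bd_cone y (link y z0); rewrite zc bdz bdlink /cone fglift0 addr0.
  exists 0; first exact: supported0.
  by rewrite bd0 zE u0 l0 /cone fglift0 addr0.
have [h1 _ h3] := H_basis y.
have [|v hv bdv] := h3 a (link y z0) nonempty _ bdlink.
  apply: (supported_link hb) => s [[s1 s2 sa] sb] ys; split.
  - by move: s1; rewrite (cardfsD1 y) ys => -[].
  - move=> x /=; rewrite !inE => /andP[xy xs]; split; first exact: s2.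
    by rewrite lt_neqAle sb // andbT (inj_eq f_inj).
  - by move=> x; rewrite !inE => /andP[_]; apply: sa.
have bdcv : bd (cone y v) = v - cone y (link y z0).
  by rewrite -bdv -[X in X - _](bd_cone y v) addrK.
have z1E : z0 + bd (cone y v) = u + v.
  by rewrite {1}zE bdcv addrACA [cone y _ - _]subrr addr0.
have z1s : supported
    (fun s => faces_above n.+1 X a s /\ forall x, x \in s -> (f x < f y)%O) (u + v).
  apply: supportedD.
    apply: (supported_subset hu) => s [[sf sb] ys]; split=> // x xs.
    rewrite lt_neqAle sb // andbT; apply: contraNneq ys => /f_inj <-.
    exact: xs.
  apply: (supported_subset hv) => s [/h1[s1 s2] sa]; split=> [|x xs].
    by split=> // x xs; case: (s2 x xs).
  by case: (s2 x xs).
have [||c hc bdc] := top (u + v).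
- by apply: (supported_subset z1s) => s [].
- move=> y' [t tz y't] hb'.
  have [[_ tX ta] tb] := z1s t tz.
  apply: (IH (f y') _ y') => //.
  + by rewrite -fyw; apply: tb.
  + exact: tX.
  + exact: ta.
  + by rewrite -z1E bdD bdz bd_bd addr0.
exists (c - cone y v); last by rewrite bdB bdc -z1E addrK.
apply: supportedB => //; apply: (supported_cone hv) => s [hs sa] ys; split.
  by exists y; rewrite fset1U1 fsetU1K.
by move=> x; rewrite !inE => /orP[/eqP->//|]; apply: sa.
Qed.

Lemma step_tail_basis : tail_basis n.+1 X H.
Proof.
by split; [exact: step_simplices|exact: step_free|move=> a z _; exact: step_fill].
Qed.

End Step.

(* Enumerate [X] with proper initial segments of smaller cardinal. A simplex with
   last vertex [y] is put in the basis when the face opposite to [y] belongs to a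
   tail basis of the segment below [y]. *)
Lemma tail_basis_exists n X : small n X -> exists H, tail_basis n X H.
Proof.
elim: n X => [|n IH] X; first exact: tail_basis0.
move=> /small_well_order[W [f [f_inj fS]]].
have /choice[H_ HP] := fun y => IH _ (fS y).
by eexists; apply: step_tail_basis f_inj HP.
Qed.

End TailBasis.

(** * Tail-acyclic complexes *)

Section TailAcyclic.
Variables (d : Order.disp_t) (T : orderType d).
Implicit Types (s t : {fset T}) (c : {freeg {fset T} / int}) (B : complex T).
Local Open Scope fset_scope.
Local Open Scope ring_scope.

Lemma cyclesE B k c : cycles B k c <-> supported (faces B k) c /\ bd c = 0.
Proof.
case: k => [|k] //=; split=> -[h1 h2]; split=> //;
  (have h : supported (fun s => #|` s| = 1%N) c by move=> s /h1[]);
  exact/(deg_eq0_bd h).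
Qed.

(** * From a tail basis to a tail-acyclic complex *)

Section FromBasis.
Variables (n : nat) (H : set {fset T}).
Hypothesis H_basis : tail_basis n setT H.

Definition basis_face s := s != fset0 /\ ((#|` s| <= n)%N \/ H s).

Lemma basis_face_neq0 s : basis_face s -> s != fset0.
Proof. by case. Qed.

Lemma basis_face_sub s t : basis_face s -> t `<=` s -> t != fset0 -> basis_face t.
Proof.
move=> [_ sH] ts t0; split=> //; have ts' := fsubset_leq_card ts.
case: sH => [sn|Hs]; first by left; apply: leq_trans sn.
case: (eqVneq t s) => [->|ts0]; [by right|left].
have [h1 _ _] := H_basis; have [s1 _] := h1 _ Hs.
by rewrite -ltnS -s1 ltnNge; apply: contra ts0 => st; rewrite eqEfcard ts st.
Qed.

Definition basis_complex : complex T := Complex basis_face_neq0 basis_face_sub.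

(** Below dimension [n - 1] cones stay in the full skeleton; in dimension [n - 1] the basis fills
    every cycle; in dimension [n] its freeness leaves no nonzero cycle; above there are no faces. *)
Lemma basis_complex_tail_acyclic s0 :
  (0 < n)%N -> #|` s0| = n.+1 -> tail_acyclic n basis_complex.
Proof.
move=> n0 s0n; have [h1 h2 h3] := H_basis.
have topE s : faces basis_complex n s <-> H s.
  split=> [[[_ [|//]]]|Hs]; first by move=> + e; rewrite e ltnn.
  have [s1 _] := h1 _ Hs; split=> //; split; last by right.
  by rewrite -cardfs_gt0 s1.
have faceE k s : (k < n)%N -> #|` s| = k.+1 -> is_face basis_complex s.
  by move=> kn s1; split; [rewrite -cardfs_gt0 s1|left; rewrite s1].
split.
- split.
    have /fset0Pn[y ys] : s0 != fset0 by rewrite -cardfs_gt0 s0n.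
    have [b bP] : exists b, lower_bounds s0 b.
      have [|b _ bP] := finite_set_argmax (fun x : T => x : T^d)%O (finite_fset s0).
        by exists y.
      by exists b => x /bP.
    (* The boundary of [s0] is a nonzero cycle, so its filling is nonzero and provides an
       [n]-face. *)
    have [||c hc bdc] := h3 b (bd << s0 >>) _ _ (bd_bd _).
    + by exists y => //; apply: bP.
    + apply: (supported_bd (supportedU (erefl s0))) => _ x <- xs; split=> //.
        by move: s0n; rewrite (cardfsD1 x) xs => -[].
      by move=> z; rewrite !inE => /andP[_]; apply: bP.
    case E: (dom c) => [|t r].
      move/eqP: E; rewrite dom_eq0 => /eqP c0.
      have := cone_bd_simplex ys; rewrite -bdc c0 bd0 /cone fglift0 => /esym/eqP.
      by rewrite freegU_eq0.
    by exists t; apply/topE; have [] := hc t; rewrite ?E ?mem_head.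
  move=> k [s [[_ sH] sk]]; case: sH => [|Hs]; first by rewrite sk => /ltnW.
  by have [s1 _] := h1 _ Hs; move: sk; rewrite s1 => -[->].
- apply/seteqP; split=> s /=; first by move=> [_ ->]; rewrite prednK.
  move=> sn; split; last by rewrite prednK.
  by apply: (faceE n.-1); rewrite ?prednK.
move=> x k c /cyclesE[hc bdc].
have [kn|kn|kn] := ltngtP k n; last first.
- suff -> : c = 0 by exists 0; [move=> s; rewrite dom0|exact: bd0].
  apply: h2 => //; rewrite kn in hc; apply: (supported_subset hc) => s [[sf _] s1].
  exact/topE.
- suff -> : c = 0 by exists 0; [move=> s; rewrite dom0|exact: bd0].
  apply: supported_eq0; apply: (supported_subset hc) => s [[[_ sH] _] s1].
  case: sH => [|/h1[s2 _]]; first by rewrite s1 ltnNge ltnW.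
  by move: kn; rewrite s1 in s2; case: s2 => ->; rewrite ltnn.
have [kn'|nk] := ltnP k.+1 n.
  exists (cone x c); last by rewrite -[RHS](bd_cone x) bdc /cone fglift0 addr0.
  apply: (supported_cone hc) => s [[sf sx] s1] xs.
  have s2 : #|` x |` s| = k.+2 by rewrite cardfsU1 xs s1.
  split=> //; split; first exact: faceE s2.
  by move=> y /=; rewrite !inE => /orP[/eqP->//|/sx].
have {}nk : n = k.+1 by apply/eqP; rewrite eqn_leq nk.
have [||v hv bdv] := h3 x c _ _ bdc; first by exists x.
  by apply: (supported_subset hc) => s [[sf sx] s1]; split=> //; rewrite nk.
exists v => // s /hv[Hs sx]; have [s1 _] := h1 _ Hs; split; last by rewrite s1 nk.
by split=> //; case/topE: Hs.
Qed.

End FromBasis.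

(** The retraction is [1 - r], where [r s] fills the boundary of [s] by [n]-faces of [B] above the
    least vertex of [s]. It fixes a cycle [c] because [r] sends [c] to an [n]-cycle of [B], hence to
    a boundary, and [B] has no [n.+1]-faces. *)
Lemma tail_acyclic_cycle_retraction n B : (0 < n)%N ->
  (forall A : set T, A !=set0 -> exists2 x, A x & forall y, A y -> (x <= y)%O)%classic ->
  tail_acyclic n B -> exists q, cycle_retraction n [set: T]%classic q.
Proof.
move=> n0 least [[[s0 [s0f s0n] dimB]] fB acB].
have [x0 _ x0P] : exists2 x0, (setT x0) & forall y : T, (setT y)%classic -> (x0 <= y)%O.
  by apply: least; have /fset0Pn[x _] := face_neq0 s0f; exists x.
have /choice[r rP] : forall s, exists c, #|` s| = n.+1 ->
    supported (fun t => faces B n t /\ lower_bounds s `<=` lower_bounds t)%classic c /\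
    bd c = bd << s >>.
  move=> s; have [s1|] := pselect (#|` s| = n.+1); last by exists 0.
  have [|m ms mP] := least [set` s]%classic.
    by have /fset0Pn[x xs] : s != fset0 by [rewrite -cardfs_gt0 s1]; exists x.
  have : cycles (restrict B [set y | (m <= y)%O]%classic) n.-1 (bd << s >>).
    apply/cyclesE; split; last exact: bd_bd.
    apply: (supported_bd (supportedU (erefl s))) => _ x <- xs.
    have s2 : #|` s `\ x| = n by move: s1; rewrite (cardfsD1 x) xs => -[].
    have [sf _] : faces B n.-1 (s `\ x) by rewrite fB.
    split; last by rewrite s2 prednK.
    by split=> // y /=; rewrite !inE => /andP[_]; apply: mP.
  move=> /(acB m n.-1)[c hc bdc]; exists c => _; split=> // t /hc[[tf tm] t1].
  split; first by split=> //; rewrite t1 prednK.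
  by move=> a sa y yt; apply: le_trans (sa m ms) (tm y yt).
have sE s : simplices n setT s -> #|` s| = n.+1 by case.
exists (fun s => << s >> - r s); split=> [s /sE s1|s /sE s1|c hc bdc].
- apply: supportedB; first by apply: supportedU; split.
  by apply: (supported_subset (rP s s1).1) => t [].
- by rewrite bdB (rP s s1).2 subrr.
have -> : fglift (fun s => << s >> - r s) c = c - fglift r c.
  apply: (eq_freeg (G := fun c => c - fglift r c)) => [|c1 c2|s].
  - exact: fgliftD.
  - by rewrite fgliftD opprD addrACA.
  - by rewrite !fgliftU.
have hr : supported (faces B n) (fglift r c).
  apply: (supported_lift hc) => s /sE s1.
  by apply: (supported_subset (rP s s1).1) => t [].
have bdr : bd (fglift r c) = 0.
  rewrite -bdc; move: hc.
  apply: (eq_supported (F := fun c => bd (fglift r c)) (G := @bd _ T)) => [c1 c2||s /sE s1].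
  - by rewrite fgliftD bdD.
  - exact: bdD.
  - by rewrite fgliftU (rP s s1).2.
suff -> : fglift r c = 0 by rewrite subr0.
(* The tail from the least vertex [x0] is the whole of [B], so tail-acyclicity applies to it. *)
have : cycles (restrict B [set y | (x0 <= y)%O]%classic) n (fglift r c).
  apply/cyclesE; split=> //; apply: (supported_subset hr) => s [sf s1].
  by split=> //; split=> // y _; apply: x0P.
move=> /(acB x0 n)[e he <-]; suff -> : e = 0 by exact: bd0.
apply: supported_eq0; apply: (supported_subset he) => s [[sf _] s1].
by have := dimB n.+1 (ex_intro _ s (conj sf s1)); rewrite ltnn.
Qed.

End TailAcyclic.

(** * Finite initial segments of well-orders *)

Section Ordinals.
Local Open Scope classical_set_scope.

Lemma wotype_least (g : wotype) (A : set g) :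
  A !=set0 -> exists2 x, A x & forall y, A y -> (x <= y)%O.
Proof.
move=> [x]; elim/(well_founded_ind (@wo_wf g)): x => x IH Ax.
have [[y [yx Ay]]|nA] := pselect (exists y, (y < x)%O /\ A y); first exact: IH yx Ay.
by exists x => // y Ay; rewrite leNgt; apply/negP => yx; apply: nA; exists y.
Qed.

Lemma infinite_initial_segment (g : wotype) n : infinite_set [set: g] ->
  exists x (s : seq g), [/\ size s = n, sorted <%O s & forall y, (y \in s) = (y < x)%O].
Proof.
move=> ginf; elim: n => [|n [x [s [sn ss sx]]]].
  have [|x _ xP] := @wotype_least g setT; first exact: infinite_setN0.
  by exists x, [::]; split=> // y; rewrite in_nil ltNge xP.
have [x' xx' x'P] : exists2 x', (x < x')%O & forall y, (x < y)%O -> (x' <= y)%O.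
  apply: (@wotype_least g [set y | (x < y)%O]); apply: contrapT => nx; apply: ginf.
  apply: sub_finite_set (finite_seq (x :: s)) => y _ /=; rewrite inE sx -le_eqVlt leNgt.
  by apply/negP => xy; apply: nx; exists y.
exists x', (rcons s x); split; first by rewrite size_rcons sn.
  case: s ss sx {sn} => //= z s ss sx; rewrite rcons_path ss -sx.
  exact: mem_last.
move=> y; rewrite mem_rcons inE sx -le_eqVlt.
by case: (leP y x) => [yx|xy]; [rewrite (le_lt_trans yx xx')|rewrite ltNge (x'P _ xy)].
Qed.

Lemma ord_lt_fin_ord (g : wotype) n : infinite_set [set: g] -> ord_lt (fin_ord n) g.
Proof.
move=> /(infinite_initial_segment n)[x [s [sn ss sx]]].
exists x, (fun i : 'I_n => nth x s i); split.
  by move=> i j; rewrite (lt_sorted_ltn_nth x ss) ?inE ?sn.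
apply/seteqP; split=> y /=; first by move=> [i _ <-]; rewrite -sx mem_nth ?sn.
rewrite -sx => ys; have ys' := ys; rewrite -index_mem sn in ys'.
by exists (Ordinal ys') => //=; rewrite nth_index.
Qed.

Lemma ord_lt_fin_ord_card (g : wotype) n :
  ord_lt (fin_ord n) g -> exists s : {fset g}, #|` s| = n.+1.
Proof.
move=> [x [f [fm fr]]].
have fI : injective f.
  by move=> i j fij; case: (ltgtP i j) => //; rewrite -fm fij ltxx.
(* The [n] points of the image lie strictly below [x], which supplies the extra element. *)
exists (x |` [fset f i | i : 'I_n])%fset.
rewrite cardfsU1 card_imfset //= size_enum_ord.
suff -> : x \notin [fset f i | i : 'I_n]%fset by [].
apply/imfsetP => -[i _ xi]; have : range f (f i) by exists i.
by rewrite fr /= -xi ltxx.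
Qed.

End Ordinals.

Theorem theorem3p5 (n : nat) (n_gt0 : 0 < n) (omega_n : wotype) :
  is_omega n omega_n ->
  is_least (fun g : wotype =>
      ord_lt (fin_ord n) g /\ ~ exists G : complex g, tail_acyclic n G)
    omega_n.
Proof.
move=> om; have [seg_small not_small] := is_omega_small om; split.
  split; first by apply: ord_lt_fin_ord => /(finite_small n).
  move=> [G /(tail_acyclic_cycle_retraction n_gt0 (@wotype_least omega_n))[q]].
  exact: no_cycle_retraction (is_omega_directed om).
move=> b [x [f [fm fr]]] [/ord_lt_fin_ord_card[s sn]]; apply.
(* As a proper segment of omega_n, [b] has cardinal at most aleph_(n-1); the set [s] of [n.+1]
   points will secure the dimension. *)
have [|H HP] := @tail_basis_exists _ b n setT.
  apply: (small_inj (f := f)) (seg_small x) => [y z _ _ fyz|y _].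
    by case: (ltgtP y z) => //; rewrite -fm fyz ltxx.
  by have : range f (f y) by [exists y]; rewrite fr.
by exists (basis_complex HP); apply: basis_complex_tail_acyclic sn.
Qed.
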